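(* Let $n\ge 2$ and $p>4$. Then the minimum of $J_p$ over $\mathcal{P}_0(\mathbb{S}^{n-1})$ is attained uniquely (up to rotations) by the measure $\mu_{\rm sim}$. In particular, $$c(n,p)=2^{\frac p2}\left(1+\frac1n\right)^{\frac p2-1}.$$
   Context: $\mathcal{P}_0(\mathbb{S}^{n-1})$ is the set of Borel probability measures $\mu$ on the unit sphere $\mathbb{S}^{n-1}\subset\mathbb{R}^n$ with barycenter $\int v\,d\mu(v)=0$. For such $\mu$, $J_p(\mu)=\iint_{\mathbb{S}^{n-1}\times\mathbb{S}^{n-1}}|v-w|^p\,d\mu(v)\,d\mu(w)$, and $c(n,p)=\inf_{\mu\in\mathcal{P}_0(\mathbb{S}^{n-1})}J_p(\mu)$. $\mu_{\rm sim}=\frac1{n+1}\sum_{i=0}^n\delta_{v_i}$, where $v_0,\dots,v_n\in\mathbb{S}^{n-1}$ are the vertices of a regular $n$-simplex inscribed in $\mathbb{S}^{n-1}$ (distinct points with $|v_i-v_j|$ constant for $i\ne j$); it is defined only up to rotations (elements of the orthogonal group), so uniqueness is understood up to rotations. *)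

(* Defs.v *)
From HB Require Import structures.
From mathcomp Require Import all_boot all_order all_algebra.
From mathcomp Require Import all_classical all_reals all_analysis.

Set Implicit Arguments.
Unset Strict Implicit.
Unset Printing Implicit Defensive.

Import Order.TTheory GRing.Theory Num.Theory.
Import numFieldNormedType.Exports.
Local Open Scope classical_set_scope.
Local Open Scope ring_scope.

(* The topology on 'rV[R]_n is the product topology, that is, the usual
   topology of R^n, so this is R^n with its Borel sigma-algebra. *)
Notation borel_rV R n := (g_sigma_algebraType (open : set (set 'rV[R]_n))).

(* The norm `| _ | that the library puts on 'rV[R]_n is the sup norm. *)
Definition eucl_norm (R : realType) (n : nat) (v : 'rV[R]_n) : R :=
  Num.sqrt (\sum_(i < n) v ord0 i ^+ 2).

Definition unit_sphere (R : realType) (n : nat) : set 'rV[R]_n :=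
  [set v | eucl_norm v = 1].
Arguments unit_sphere : clear implicits.

Definition barycenter (R : realType) (n : nat)
    (mu : probability (borel_rV R n) R) : 'rV[R]_n :=
  \row_(i < n) \int[mu]_(v in unit_sphere R n) (v : 'rV[R]_n) ord0 i.

(* A Borel probability measure on the sphere is identified with its extension
   by zero, a Borel probability measure on R^n that gives the sphere mass 1. *)
Definition centered_on_sphere (R : realType) (n : nat) :=
  [set mu : probability (borel_rV R n) R |
    mu (unit_sphere R n) = 1%E /\ barycenter mu = 0].
Arguments centered_on_sphere : clear implicits.

Definition energy (R : realType) (n : nat) (p : R)
    (mu : probability (borel_rV R n) R) : \bar R :=
  (\int[mu]_(v in unit_sphere R n) \int[mu]_(w in unit_sphere R n)
     (eucl_norm ((v : 'rV[R]_n) - (w : 'rV[R]_n)) `^ p)%:E)%E.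

Definition min_energy (R : realType) (n : nat) (p : R) : \bar R :=
  ereal_inf [set energy p mu | mu in centered_on_sphere R n].
Arguments min_energy {R} n p.

Definition is_minimizer (R : realType) (n : nat) (p : R)
    (mu : probability (borel_rV R n) R) : Prop :=
  centered_on_sphere R n mu /\
  forall nu : probability (borel_rV R n) R,
    centered_on_sphere R n nu -> (energy p mu <= energy p nu)%E.

Definition regular_simplex (R : realType) (n : nat)
    (v : 'I_n.+1 -> 'rV[R]_n) : Prop :=
  [/\ forall i, unit_sphere R n (v i), injective v &
      exists d : R, forall i j, i != j -> eucl_norm (v i - v j) = d].

Definition uniform_on_points (R : realType) (n : nat)
    (v : 'I_n.+1 -> 'rV[R]_n) : set (borel_rV R n) -> \bar R :=
  mscale (n.+1%:R^-1)%:nng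
    (msum (fun i => @dirac _ (borel_rV R n) (v (inord i)) R) n.+1).

HB.instance Definition _ (R : realType) (n : nat) (v : 'I_n.+1 -> 'rV[R]_n) :=
  Measure.on (uniform_on_points v).

Lemma uniform_on_pointsE (R : realType) (n : nat) (v : 'I_n.+1 -> 'rV[R]_n)
    (A : set (borel_rV R n)) :
  uniform_on_points v A
  = ((n.+1%:R^-1)%:E * \sum_(i < n.+1) @dirac _ (borel_rV R n) (v i) R A)%E.
Proof.
rewrite /uniform_on_points /mscale /= /msum; congr (_ * _)%E.
by apply: eq_bigr => i _; rewrite inord_val.
Qed.

Lemma uniform_on_points_setT (R : realType) (n : nat)
    (v : 'I_n.+1 -> 'rV[R]_n) :
  uniform_on_points v [set: borel_rV R n] = 1%E.
Proof.
rewrite uniform_on_pointsE (eq_bigr (fun=> 1%E)); last first.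
  by move=> i _; rewrite diracT.
by rewrite sumEFin big_const_ord iter_addr_0 -EFinM mulVf ?pnatr_eq0.
Qed.

HB.instance Definition _ (R : realType) (n : nat) (v : 'I_n.+1 -> 'rV[R]_n) :=
  Measure_isProbability.Build _ _ _ (uniform_on_points v)
    (uniform_on_points_setT v).

Definition mu_sim (R : realType) (n : nat) (v : 'I_n.+1 -> 'rV[R]_n) :
  probability (borel_rV R n) R := uniform_on_points v.

Definition orthogonalmx (R : realType) (n : nat) (U : 'M[R]_n) : Prop :=
  U *m U^T = 1%:M.

(* The rotation U acts on row vectors by v |-> v *m U.  Measures are compared
   on Borel sets only: the library's measures are total set functions, whose
   values on non-measurable sets are arbitrary. *)
Definition equal_up_to_rotation (R : realType) (n : nat)
    (mu nu : probability (borel_rV R n) R) : Prop :=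
  exists2 U : 'M[R]_n, orthogonalmx U &
    forall A : set (borel_rV R n), measurable A ->
      mu A = pushforward nu
        ((fun x : 'rV[R]_n => x *m U) : borel_rV R n -> borel_rV R n) A.

(* Main.v *)
Require Import Defs.
From mathcomp Require Import all_boot all_order all_algebra.
From mathcomp Require Import all_classical all_reals all_analysis.
From mathcomp Require Import measurable_realfun.
From mathcomp Require Import ring lra.
Import Order.TTheory GRing.Theory Num.Theory.
Import numFieldNormedType.Exports.
Set Implicit Arguments.
Unset Strict Implicit.
Unset Printing Implicit Defensive.

Local Open Scope classical_set_scope.
Local Open Scope ring_scope.

(** On the sphere, put s = 1 - <v, w>, so that |v - w|^p = 2^(r+1) s^(r+1) with
    r = p/2 - 1 > 1.  For the regular simplex, s only takes the values 0 (on
    the diagonal) and a = 1 + 1/n (off the diagonal).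

    The lower bound is a linear programming bound.  Replacing s^r by its tangent
    at a, which lies below it by Bernoulli's inequality, and multiplying by
    s >= 0 gives
      s^(r+1) >= (1 - r) a^r s + r a^(r-1) s^2,
    with equality only at s = 0 and s = a ([tangent_gap_eq0]).  The right-hand
    side is quadratic in <v, w>, so its double integral only involves the first
    two moments of mu.  The barycenter is 0, so the double integral of s is 1;
    and that of s^2 is 1 plus the sum of the squares of the entries of the
    second moment matrix M.  As M is an n x n matrix of trace 1, this sum is at
    least 1/n ([second_moment_sqr_ge]), so the double integral of s^2 is at
    least a.  The coefficient of s^2 being positive, the double integral of
    s^(r+1) is at least a^r ([energy_ge]), which is its value at a simplex
    ([energy_mu_sim]).

    In the case of equality, almost every v has the property that <v, w> is 1 or
    -1/n for almost every w ([energy_min_gap]).  For such a v, the function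
    w |-> <v, w> is almost everywhere 1 at v and -1/n elsewhere; its integral
    being 0, v is an atom of mass 1/(n+1) ([simplex_point_atom]).  As almost
    every point is such an atom, there are exactly n+1 of them, and the scalar
    products between them are those of a regular simplex
    ([ae_simplex_point_uniform]).

    It remains to see that a regular simplex is determined by its Gram matrix
    up to rotation.  The n+1 unit vectors of R^n with a constant distance are
    linearly dependent, which forces their scalar products to be -1/n
    ([regular_simplex_gram]).  They form a tight frame: V^T V = a I, where the
    rows of V are the vertices ([simplex_tight_frame]).  Hence
    U = V^T W / a is orthogonal and sends the simplex V to the simplex W
    ([simplex_gram_rotation]). *)

(** * The tangent inequality *)

(** Weighted arithmetic-geometric mean inequality for y^r and 1: with
    y = exp a, both exp (r a) and exp 0 lie above the tangent to exp at a, and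
    the weights 1 and r - 1 cancel the slopes of these tangents. *)
Lemma bernoulli_powR (R : realType) (r y : R) :
  1 < r -> 0 <= y -> y != 1 -> 1 + r * (y - 1) < y `^ r.
Proof.
move=> r1; rewrite le_eqVlt => /predU1P[<-|y0] y1.
  have r0 : r != 0 by rewrite gt_eqF// (lt_trans ltr01).
  by rewrite powR0//; lra.
pose a := ln y.
have ya : y = expR a by rewrite lnK// posrE.
have a0 : a != 0 by rewrite ln_eq0.
have -> : y `^ r = expR (r * a) by rewrite /powR gt_eqF.
have h1 : expR a * (1 + (r - 1) * a) < expR (r * a).
  rewrite (_ : r * a = a + (r - 1) * a); last by ring.
  rewrite expRD ltr_pM2l ?expR_gt0//; apply: expR_gt1Dx.
  by rewrite mulf_neq0// subr_eq0 gt_eqF.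
have h2 : expR a * (1 - a) <= 1.
  rewrite -[leRHS](expRxMexpNx_1 a) ler_pM2l ?expR_gt0//; exact: expR_ge1Dx.
have h3 : 0 < r - 1 by rewrite subr_gt0.
rewrite ya; move: h1 h2; set E := expR a; nra.
Qed.

(** The difference between s^(r+1) and s times the tangent at a to s |-> s^r. *)
Definition tangent_gap (R : realType) (r a s : R) : R :=
  s `^ (r + 1) - ((1 - r) * a `^ r * s + r * a `^ r / a * s ^+ 2).

Section TangentGap.
Context (R : realType) (r a : R) (r1 : 1 < r) (a0 : 0 < a).

Lemma tangent_gapE s : 0 <= s -> tangent_gap r a s =
  a `^ r * s * ((s / a) `^ r - (1 + r * (s / a - 1))).
Proof.
move=> s0; rewrite /tangent_gap powRD; last first.
  by apply/implyP => /eqP r10; move: r1 r10; lra.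
rewrite powRr1// {1}(_ : s = a * (s / a)); last by rewrite mulrCA divff ?mulr1 ?gt_eqF.
rewrite powRM ?divr_ge0 ?(ltW a0)//.
by field; rewrite gt_eqF.
Qed.

Lemma tangent_gap_ge0 s : 0 <= s -> 0 <= tangent_gap r a s.
Proof.
move=> s0; rewrite tangent_gapE// mulr_ge0 ?mulr_ge0 ?powR_ge0// subr_ge0.
have [->|y1] := eqVneq (s / a) 1; first by rewrite powR1 subrr mulr0 addr0.
by rewrite ltW// bernoulli_powR// divr_ge0// ltW.
Qed.

Lemma tangent_gap_eq0 s : 0 <= s -> tangent_gap r a s = 0 -> s = 0 \/ s = a.
Proof.
move=> s0; rewrite tangent_gapE// => /eqP; rewrite mulf_eq0 => /orP[|].
  by rewrite mulf_eq0 powR_eq0 gt_eqF//= => /eqP; left.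
rewrite subr_eq0 => /eqP E; right.
have [y1|y1] := eqVneq (s / a) 1; first by rewrite -[s](divfK (lt0r_neq0 a0)) y1 mul1r.
by have := bernoulli_powR r1 (divr_ge0 s0 (ltW a0)) y1; rewrite E ltxx.
Qed.

End TangentGap.

(** * Integration of bounded functions *)

(** Bounded measurable functions are stable under sums and products and are
    integrable for every probability measure; all the integrands below are of
    this kind, which reduces integrability conditions to closure rules. *)
Definition bounded_measurable d (T : measurableType d) (R : realType)
    (D : set T) (f : T -> R) : Prop :=
  measurable_fun D f /\ exists C, forall x, D x -> `|f x| <= C.

Section BoundedMeasurable.
Context d (T : measurableType d) (R : realType) (D : set T).
Implicit Types f g : T -> R.

Lemma bounded_measurable_cst k : bounded_measurable D (fun=> k : R).
Proof. by split=> //; exists `|k|. Qed.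

Lemma bounded_measurableD f g : bounded_measurable D f ->
  bounded_measurable D g -> bounded_measurable D (fun x => f x + g x).
Proof.
move=> [mf [A fA]] [mg [B gB]]; split; first exact: measurable_funD.
by exists (A + B) => x Dx; rewrite (le_trans (ler_normD _ _))// lerD// (fA, gB).
Qed.

Lemma bounded_measurableM f g : bounded_measurable D f ->
  bounded_measurable D g -> bounded_measurable D (fun x => f x * g x).
Proof.
move=> [mf [A fA]] [mg [B gB]]; split; first exact: measurable_funM.
exists (A * B) => x Dx.
by rewrite normrM ler_pM// (fA, gB).
Qed.

Lemma bounded_measurable_sum I (s : seq I) (h : I -> T -> R) :
  (forall i, bounded_measurable D (h i)) ->
  bounded_measurable D (fun x => \sum_(i <- s) h i x).
Proof.
move=> bh; elim: s => [|i s ih].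
  by under eq_fun do rewrite big_nil; exact: bounded_measurable_cst.
by under eq_fun do rewrite big_cons; exact: bounded_measurableD.
Qed.

End BoundedMeasurable.

Section RintegralBounded.
Context d (T : measurableType d) (R : realType) (mu : probability T R).
Context (D : set T) (mD : measurable D).
Implicit Types f g : T -> R.

Lemma bounded_measurable_integrable f :
  bounded_measurable D f -> mu.-integrable D (EFin \o f).
Proof.
move=> [mf [C fC]]; apply: measurable_bounded_integrable => //.
  by rewrite (le_lt_trans (probability_le1 _ _))// ltry.
exists C; split; first exact: num_real.
by move=> M CM x Dx /=; rewrite (le_trans (fC _ Dx))// ltW.
Qed.

Lemma EFin_Rintegral f : bounded_measurable D f ->
  (\int[mu]_(x in D) (f x)%:E)%E = (\int[mu]_(x in D) f x)%:E.
Proof.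
move=> bf; rewrite /Rintegral fineK//.
exact/integrable_fin_num/bounded_measurable_integrable.
Qed.

Lemma bounded_RintegralD f g : bounded_measurable D f -> bounded_measurable D g ->
  \int[mu]_(x in D) (f x + g x) = \int[mu]_(x in D) f x + \int[mu]_(x in D) g x.
Proof. by move=> bf bg; rewrite RintegralD//; exact: bounded_measurable_integrable. Qed.

Lemma bounded_RintegralZl f k : bounded_measurable D f ->
  \int[mu]_(x in D) (k * f x) = k * \int[mu]_(x in D) f x.
Proof. by move=> bf; rewrite RintegralZl//; exact: bounded_measurable_integrable. Qed.

Lemma bounded_Rintegral_sum I (s : seq I) (h : I -> T -> R) :
  (forall i, bounded_measurable D (h i)) ->
  \int[mu]_(x in D) (\sum_(i <- s) h i x) =
  \sum_(i <- s) \int[mu]_(x in D) h i x.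
Proof.
move=> bh; elim: s => [|i s ih].
  under eq_Rintegral do rewrite big_nil.
  by rewrite Rintegral_cst// mul0r big_nil.
under eq_Rintegral do rewrite big_cons.
by rewrite bounded_RintegralD// ?ih ?big_cons//; exact: bounded_measurable_sum.
Qed.

Lemma Rintegral_eq0_ae f : bounded_measurable D f -> (forall x, D x -> 0 <= f x) ->
  \int[mu]_(x in D) f x = 0 -> {ae mu, forall x, D x -> f x = 0}.
Proof.
move=> bf f0 If.
have : ae_eq mu D (EFin \o f) (cst 0%E).
  apply/ae_eq_integral_abs => //; first by apply/measurable_EFinP; case: bf.
  transitivity (\int[mu]_(x in D) (f x)%:E)%E; last by rewrite EFin_Rintegral// If.
  by apply: eq_integral => x /[!inE] Dx; rewrite /= ger0_norm// f0.
by apply: filterS => x h Dx; have [] := h Dx.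
Qed.

Lemma ae_eq_Rintegral f g : bounded_measurable D f -> bounded_measurable D g ->
  {ae mu, forall x, D x -> f x = g x} ->
  \int[mu]_(x in D) f x = \int[mu]_(x in D) g x.
Proof.
move=> [mf _] [mg _] fg; congr fine; apply: ae_eq_integral => //.
- exact/measurable_EFinP.
- exact/measurable_EFinP.
- by apply: filterS fg => x h Dx; rewrite h.
Qed.

(** Tonelli's theorem makes the inner integral of an iterated integral
    measurable. *)
Lemma measurable_Rintegral_section (f : T * T -> R) :
  measurable_fun setT f -> (forall z, 0 <= f z) ->
  measurable_fun setT (fun x => \int[mu]_(y in D) f (x, y)).
Proof.
move=> mf f0.
pose F (z : T * T) := (f z * \1_D z.2)%:E.
have mF : measurable_fun setT F.
  apply/measurable_EFinP; apply: measurable_funM => //.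
  exact: measurableT_comp.
have F0 z : (0 <= F z)%E by rewrite lee_fin mulr_ge0.
apply: measurableT_comp => //.
rewrite (_ : (fun _ => _) = fubini_F mu F).
  exact: measurable_fun_fubini_tonelli_F.
apply/funext => x; rewrite /fubini_F integral_mkcond; apply: eq_integral => y _.
by rewrite patchE /F/= indicE; case: ifP => _; rewrite ?mulr1// mulr0.
Qed.

End RintegralBounded.

(** * Scalar products on the sphere *)

Definition dotv (R : realType) n (v w : 'rV[R]_n) : R :=
  \sum_(i < n) v ord0 i * w ord0 i.

Section Dotv.
Context (R : realType) (n : nat).
Implicit Types v w : 'rV[R]_n.

Lemma dotvC v w : dotv v w = dotv w v.
Proof. by apply: eq_bigr => i _; rewrite mulrC. Qed.

Lemma dotvDr u v w : dotv u (v + w) = dotv u v + dotv u w.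
Proof. by rewrite -big_split; apply: eq_bigr => i _; rewrite mxE mulrDr. Qed.

Lemma dotvZr k u v : dotv u (k *: v) = k * dotv u v.
Proof. by rewrite big_distrr; apply: eq_bigr => i _; rewrite mxE mulrCA. Qed.

Lemma dotvNr u v : dotv u (- v) = - dotv u v.
Proof. by rewrite -scaleN1r dotvZr mulN1r. Qed.

Lemma dotvBB v w :
  dotv (v - w) (v - w) = dotv v v - 2 * dotv v w + dotv w w.
Proof.
rewrite dotvDr dotvNr dotvC dotvDr dotvNr [dotv (_ - _) w]dotvC.
by rewrite dotvDr dotvNr (dotvC w v); ring.
Qed.

Lemma dotvv_ge0 v : 0 <= dotv v v.
Proof. by apply: sumr_ge0 => i _; rewrite -expr2 sqr_ge0. Qed.

Lemma dotvv_eq0 v : dotv v v = 0 -> v = 0.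
Proof.
move=> v0; apply/rowP => i; rewrite mxE.
have /psumr_eq0P h : forall i, true -> 0 <= v ord0 i * v ord0 i.
  by move=> j _; rewrite -expr2 sqr_ge0.
by have /eqP := h v0 i isT; rewrite mulf_eq0 orbb => /eqP.
Qed.

Lemma eucl_normE v : eucl_norm v = Num.sqrt (dotv v v).
Proof. by congr Num.sqrt; apply: eq_bigr => i _; rewrite expr2. Qed.

Lemma unit_sphereE v : unit_sphere R n v <-> dotv v v = 1.
Proof.
rewrite /unit_sphere /= eucl_normE; split=> [v1|->]; last by rewrite sqrtr1.
by rewrite -[LHS]sqr_sqrtr ?dotvv_ge0// v1 expr1n.
Qed.

Lemma sphere_dotvBB v w : unit_sphere R n v -> unit_sphere R n w ->
  dotv (v - w) (v - w) = 2 * (1 - dotv v w).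
Proof. by move=> /unit_sphereE v1 /unit_sphereE w1; rewrite dotvBB v1 w1; ring. Qed.

Lemma sphere_dotv_le1 v w : unit_sphere R n v -> unit_sphere R n w ->
  `|dotv v w| <= 1.
Proof.
move=> v1 w1; have := dotvv_ge0 (v - w); rewrite sphere_dotvBB// => h1.
have w1' : unit_sphere R n (- w).
  by apply/unit_sphereE; rewrite dotvNr dotvC dotvNr opprK; exact/unit_sphereE.
have := dotvv_ge0 (v - - w); rewrite sphere_dotvBB//.
rewrite dotvNr => h2; rewrite ler_norml; apply/andP; split; lra.
Qed.

Lemma sphere_dotv_eq1 v w : unit_sphere R n v -> unit_sphere R n w ->
  dotv v w = 1 -> v = w.
Proof.
move=> v1 w1 vw; apply/eqP; rewrite -subr_eq0; apply/eqP/dotvv_eq0.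
by rewrite sphere_dotvBB// vw subrr mulr0.
Qed.

Lemma sphere_dist v w : unit_sphere R n v -> unit_sphere R n w ->
  eucl_norm (v - w) = Num.sqrt (2 * (1 - dotv v w)).
Proof. by move=> v1 w1; rewrite eucl_normE sphere_dotvBB. Qed.

Lemma sphere_dist_powR p v w : unit_sphere R n v -> unit_sphere R n w ->
  eucl_norm (v - w) `^ p = 2 `^ (p / 2) * (1 - dotv v w) `^ (p / 2).
Proof.
move=> v1 w1; have s0 : 0 <= 1 - dotv v w.
  by rewrite subr_ge0 (le_trans (ler_norm _))// sphere_dotv_le1.
rewrite sphere_dist// -powR12_sqrt ?mulr_ge0// -powRrM.
by rewrite (mulrC _ p) powRM.
Qed.

(** The coordinates are continuous.  Their measurability gives that of the
    scalar product for the product sigma-algebra, without comparing the latter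
    with the Borel sigma-algebra of the product. *)
Lemma coord_measurable i :
  measurable_fun setT ((fun v : 'rV[R]_n => v ord0 i) : borel_rV R n -> R).
Proof.
apply: (measurability _ (RGenOpens.measurableE R)).
move=> _ [_ [a [b ->] <-]]; rewrite setTI; apply: sub_sigma_algebra.
exact: (proj1 (continuousP _) (@coord_continuous R 1 n ord0 i) _ (interval_open _ _)).
Qed.

Lemma dotv_measurable : measurable_fun setT
  ((fun z : 'rV[R]_n * 'rV[R]_n => dotv z.1 z.2) :
    borel_rV R n * borel_rV R n -> R).
Proof.
apply: measurable_sum => i; apply: measurable_funM.
- exact: (measurableT_comp (coord_measurable i) measurable_fst).
- exact: (measurableT_comp (coord_measurable i) measurable_snd).
Qed.

Lemma measurable_sphere : measurable (unit_sphere R n : set (borel_rV R n)).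
Proof.
have mf : measurable_fun setT ((fun v : 'rV[R]_n => dotv v v) : borel_rV R n -> R).
  by apply: measurable_sum => i; apply: measurable_funM; exact: coord_measurable.
have := mf measurableT _ (measurable_set1 1); rewrite setTI.
by congr measurable; apply/seteqP; split => v /=; rewrite -unit_sphereE.
Qed.

Lemma measurable_point v : measurable ([set v] : set (borel_rV R n)).
Proof.
rewrite (_ : [set v] = \bigcap_(i in [set: 'I_n])
    ((fun w : 'rV[R]_n => w ord0 i) @^-1` [set v ord0 i])); last first.
  apply/seteqP; split=> [w -> i //|w h]; apply/rowP => i; exact: h.
apply: fin_bigcap_measurable => // i _; rewrite -[X in measurable X]setTI.
exact: (coord_measurable i).
Qed.

End Dotv.

Lemma coord_bounded_measurable (R : realType) n i :
  bounded_measurable (unit_sphere R n : set (borel_rV R n))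
    (fun v => (v : 'rV[R]_n) ord0 i).
Proof.
split; first exact: measurable_funTS (@coord_measurable R n i).
exists 1 => v /unit_sphereE v1; rewrite -(@expr_le1 _ 2)// real_normK ?num_real//.
rewrite -v1 /dotv (bigD1 i)//= -expr2 lerDl.
by apply: sumr_ge0 => j _; rewrite -expr2 sqr_ge0.
Qed.

Lemma dotv_bounded_measurable (R : realType) n (v : 'rV[R]_n) :
  bounded_measurable (unit_sphere R n : set (borel_rV R n)) (fun w => dotv v w).
Proof.
apply: bounded_measurable_sum => i; apply: bounded_measurableM.
  exact: bounded_measurable_cst.
exact: coord_bounded_measurable.
Qed.

Lemma measurable_dist_powR (R : realType) n (q : R) : measurable_fun setT
  ((fun z : 'rV[R]_n * 'rV[R]_n => (1 - dotv z.1 z.2) `^ q) :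
    borel_rV R n * borel_rV R n -> R).
Proof.
apply: (measurableT_comp (measurable_powR q)); apply: measurable_funB => //.
exact: dotv_measurable.
Qed.

Lemma dist_powR_bounded_measurable (R : realType) n (q : R) (v : 'rV[R]_n) :
  0 <= q -> unit_sphere R n v ->
  bounded_measurable (unit_sphere R n : set (borel_rV R n))
    (fun w => (1 - dotv v w) `^ q).
Proof.
move=> q0 v1; split.
  apply: (measurableT_comp (measurable_powR q)); apply: measurable_funB => //.
  by have [] := dotv_bounded_measurable v.
exists (2 `^ q) => w w1; rewrite ger0_norm ?powR_ge0//.
have := sphere_dotv_le1 v1 w1; rewrite ler_norml => /andP[h1 h2].
by apply: ge0_ler_powR => //; rewrite ?nnegrE; lra.
Qed.

(** * The lower bound *)

Section CenteredMeasure.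
Context (R : realType) (n : nat) (mu : probability (borel_rV R n) R).
Hypothesis mu_centered : centered_on_sphere R n mu.

Local Notation D := (unit_sphere R n).
Let mD : measurable (D : set (borel_rV R n)) := @measurable_sphere R n.

Lemma sphere_Rintegral_cst k : \int[mu]_(v in D) k = k.
Proof. by rewrite Rintegral_cst//= mu_centered.1 mulr1. Qed.

Lemma Rintegral_coord i : \int[mu]_(v in D) (v : 'rV[R]_n) ord0 i = 0.
Proof. by have /rowP/(_ i) := mu_centered.2; rewrite !mxE. Qed.

Lemma Rintegral_dotv (v : 'rV[R]_n) : \int[mu]_(w in D) dotv v w = 0.
Proof.
rewrite bounded_Rintegral_sum//; last first.
  move=> i; apply: bounded_measurableM; first exact: bounded_measurable_cst.
  exact: coord_bounded_measurable.
apply: big1 => i _; rewrite bounded_RintegralZl ?Rintegral_coord ?mulr0//.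
exact: coord_bounded_measurable.
Qed.

Definition second_moment i j : R :=
  \int[mu]_(v in D) ((v : 'rV[R]_n) ord0 i * (v : 'rV[R]_n) ord0 j).

Definition second_moment_form (v : 'rV[R]_n) : R :=
  \sum_i \sum_j v ord0 i * v ord0 j * second_moment i j.

Let bm_coord2 i j : bounded_measurable (D : set (borel_rV R n))
  (fun v => (v : 'rV[R]_n) ord0 i * (v : 'rV[R]_n) ord0 j).
Proof. by apply: bounded_measurableM; exact: coord_bounded_measurable. Qed.

Let bmZ (k : R) (f : borel_rV R n -> R) : bounded_measurable (D : set (borel_rV R n)) f ->
  bounded_measurable (D : set (borel_rV R n)) (fun x => k * f x).
Proof. by move=> bf; apply: bounded_measurableM => //; exact: bounded_measurable_cst. Qed.

Let bmN (f : borel_rV R n -> R) : bounded_measurable (D : set (borel_rV R n)) f ->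
  bounded_measurable (D : set (borel_rV R n)) (fun x => - f x).
Proof.
move=> bf; rewrite (_ : (fun x => - f x) = (fun x => -1 * f x)); first exact: bmZ.
by apply/funext => x; rewrite mulN1r.
Qed.

Lemma Rintegral_dotv_sqr (v : 'rV[R]_n) :
  \int[mu]_(w in D) (dotv v w ^+ 2) = second_moment_form v.
Proof.
transitivity (\int[mu]_(w in D) (\sum_i \sum_j (v ord0 i * v ord0 j) *
   ((w : 'rV[R]_n) ord0 i * (w : 'rV[R]_n) ord0 j))).
  apply: eq_Rintegral => w _; rewrite expr2 big_distrlr; apply: eq_bigr => i _.
  by apply: eq_bigr => j _; rewrite mulrACA.
rewrite bounded_Rintegral_sum//; last first.
  by move=> i; apply: bounded_measurable_sum => j; exact: bmZ.
apply: eq_bigr => i _; rewrite bounded_Rintegral_sum; last 2 first; try by [].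
  by move=> j; exact: bmZ.
by apply: eq_bigr => j _; rewrite bounded_RintegralZl.
Qed.

Lemma second_moment_form_bounded_measurable :
  bounded_measurable (D : set (borel_rV R n)) second_moment_form.
Proof.
apply: bounded_measurable_sum => i; apply: bounded_measurable_sum => j.
by apply: bounded_measurableM => //; exact: bounded_measurable_cst.
Qed.

Lemma Rintegral_second_moment_form :
  \int[mu]_(v in D) second_moment_form v = \sum_i \sum_j second_moment i j ^+ 2.
Proof.
have b i j : bounded_measurable (D : set (borel_rV R n))
    (fun v => (v : 'rV[R]_n) ord0 i * (v : 'rV[R]_n) ord0 j * second_moment i j).
  by apply: bounded_measurableM => //; exact: bounded_measurable_cst.
rewrite bounded_Rintegral_sum//; last first.
  by move=> i; exact: bounded_measurable_sum.
apply: eq_bigr => i _; rewrite bounded_Rintegral_sum//; apply: eq_bigr => j _.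
by under eq_Rintegral do rewrite mulrC; rewrite bounded_RintegralZl// expr2.
Qed.

Lemma second_moment_trace : \sum_i second_moment i i = 1.
Proof.
rewrite -[RHS](sphere_Rintegral_cst 1) -bounded_Rintegral_sum//.
by apply: eq_Rintegral => v /[!inE] /unit_sphereE.
Qed.

(** The difference is the squared Hilbert-Schmidt distance from the second
    moment matrix to I/n. *)
Lemma second_moment_sqr_ge : (0 < n)%N ->
  n%:R^-1 <= \sum_i \sum_j second_moment i j ^+ 2.
Proof.
move=> n0; have nn0 : n%:R != 0 :> R by rewrite pnatr_eq0 -lt0n.
rewrite -subr_ge0.
suff -> : \sum_i \sum_j second_moment i j ^+ 2 - n%:R^-1 =
    \sum_i \sum_j (second_moment i j - (i == j)%:R / n%:R) ^+ 2.
  by apply: sumr_ge0 => i _; apply: sumr_ge0 => j _; exact: sqr_ge0.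
transitivity (\sum_i (\sum_j second_moment i j ^+ 2
    + (n%:R^-1 ^+ 2 - 2 / n%:R * second_moment i i))).
  rewrite big_split/= sumrB sumr_const card_ord -mulr_sumr second_moment_trace.
  by rewrite -(mulr_natr (_ ^+ 2)) mulr1; congr (_ + _); field.
apply: eq_bigr => i _; rewrite (bigD1 i)//= [RHS](bigD1 i)//= eqxx.
rewrite addrAC; congr (_ + _); first by rewrite mulr1n; field.
apply: eq_bigr => j; by rewrite eq_sym => /negPf ->; rewrite mul0r subr0.
Qed.

Section Energy.
Context (r : R) (r1 : 1 < r) (n0 : (0 < n)%N).

Let a : R := 1 + n%:R^-1.
Let a0 : 0 < a. Proof. by rewrite ltr_wpDr ?invr_ge0. Qed.
Let q0 : 0 <= r + 1. Proof. by move: r1; lra. Qed.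

(** The energy left at v by the tangent inequality. *)
Definition gap_potential (v : 'rV[R]_n) : R :=
  \int[mu]_(w in D) tangent_gap r a (1 - dotv v w).

Lemma sphere_gap_ge0 v w : D v -> D w -> 0 <= tangent_gap r a (1 - dotv v w).
Proof.
move=> v1 w1; apply: tangent_gap_ge0 => //.
by rewrite subr_ge0 (le_trans (ler_norm _))// sphere_dotv_le1.
Qed.

Let bm_poly (v : 'rV[R]_n) (b c : R) : bounded_measurable (D : set (borel_rV R n))
  (fun w => b * (1 - dotv v w) + c * (1 - dotv v w) ^+ 2).
Proof.
have h : bounded_measurable (D : set (borel_rV R n)) (fun w => 1 - dotv v w).
  apply: bounded_measurableD; first exact: bounded_measurable_cst.
  by apply: bmN; exact: dotv_bounded_measurable.
apply: bounded_measurableD; first exact: bmZ.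
by apply: bmZ; under eq_fun do rewrite expr2; exact: bounded_measurableM.
Qed.

Lemma sphere_gap_bounded_measurable v : D v ->
  bounded_measurable (D : set (borel_rV R n))
    (fun w => tangent_gap r a (1 - dotv v w)).
Proof.
move=> v1; apply: bounded_measurableD; first exact: dist_powR_bounded_measurable.
by apply: bmN; exact: bm_poly.
Qed.

Lemma Rintegral_dist_poly (v : 'rV[R]_n) (b c : R) :
  \int[mu]_(w in D) (b * (1 - dotv v w) + c * (1 - dotv v w) ^+ 2) =
  b + c * (1 + second_moment_form v).
Proof.
have bd := @dotv_bounded_measurable R n v.
transitivity (\int[mu]_(w in D)
    ((b + c) + ((- (b + 2 * c)) * dotv v w + c * dotv v w ^+ 2))).
  by apply: eq_Rintegral => w _; ring.
have bd2 : bounded_measurable (D : set (borel_rV R n)) (fun w => dotv v w ^+ 2).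
  by under eq_fun do rewrite expr2; exact: bounded_measurableM.
rewrite bounded_RintegralD//; last 2 first.
- exact: bounded_measurable_cst.
- by apply: bounded_measurableD; exact: bmZ.
rewrite sphere_Rintegral_cst bounded_RintegralD//; [|exact: bmZ..].
rewrite !bounded_RintegralZl// Rintegral_dotv Rintegral_dotv_sqr.
by ring.
Qed.

Lemma Rintegral_dist_powR v : D v ->
  \int[mu]_(w in D) ((1 - dotv v w) `^ (r + 1)) =
  (1 - r) * a `^ r + r * a `^ r / a * (1 + second_moment_form v)
  + gap_potential v.
Proof.
move=> v1; rewrite -Rintegral_dist_poly -bounded_RintegralD//.
- by apply: eq_Rintegral => w _; rewrite /tangent_gap [RHS]addrC subrK.
- exact: sphere_gap_bounded_measurable.
Qed.

Lemma Rintegral_dist_powR_bounded_measurable :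
  bounded_measurable (D : set (borel_rV R n))
    (fun v => \int[mu]_(w in D) ((1 - dotv v w) `^ (r + 1))).
Proof.
split.
  apply: measurable_funTS.
  apply: (@measurable_Rintegral_section _ _ _ mu D mD (fun z => (1 - dotv z.1 z.2) `^ (r + 1))).
    exact: measurable_dist_powR.
  by move=> z; exact: powR_ge0.
exists (2 `^ (r + 1)) => v v1; rewrite ger0_norm; last first.
  by apply: Rintegral_ge0 => w _; exact: powR_ge0.
rewrite -[leRHS](sphere_Rintegral_cst (2 `^ (r + 1))); apply: le_Rintegral => //.
- exact/bounded_measurable_integrable/dist_powR_bounded_measurable.
- exact/bounded_measurable_integrable/bounded_measurable_cst.
move=> w w1; have := sphere_dotv_le1 v1 w1; rewrite ler_norml => /andP[h1 h2].
by apply: ge0_ler_powR => //; rewrite ?nnegrE; lra.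
Qed.

(** The potential is obtained as a difference because Tonelli's theorem asks for
    a nonnegative integrand on the whole product, and the tangent gap is only
    nonnegative on the sphere. *)
Lemma gap_potential_bounded_measurable :
  bounded_measurable (D : set (borel_rV R n)) gap_potential.
Proof.
pose f v := \int[mu]_(w in D) ((1 - dotv v w) `^ (r + 1)) + ((-1) *
  ((1 - r) * a `^ r + r * a `^ r / a * (1 + second_moment_form v))).
have [mf [C fC]] : bounded_measurable (D : set (borel_rV R n)) f.
  apply: bounded_measurableD; first exact: Rintegral_dist_powR_bounded_measurable.
  apply: bmZ; apply: bounded_measurableD; first exact: bounded_measurable_cst.
  apply: bmZ; apply: bounded_measurableD; first exact: bounded_measurable_cst.
  exact: second_moment_form_bounded_measurable.
have fE v : D v -> f v = gap_potential v.
  by move=> v1; rewrite /f Rintegral_dist_powR// mulN1r addrC addrA addNr add0r.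
split; last by exists C => v v1; rewrite -fE// fC.
by apply: eq_measurable_fun mf => v /[!inE]; exact: fE.
Qed.

Lemma gap_potential_ge0 v : D v -> 0 <= gap_potential v.
Proof. by move=> v1; apply: Rintegral_ge0 => w w1; exact: sphere_gap_ge0. Qed.

(** The energy is its value at a simplex, plus two nonnegative terms: the first
    vanishes when the second moment matrix is I/n, the second when almost all
    pairs of points are at the distances found in a simplex. *)
Lemma energyE p : p = 2 * (r + 1) ->
  energy p mu = (2 `^ (r + 1) * (a `^ r
     + r * a `^ r / a * (\sum_i \sum_j second_moment i j ^+ 2 - n%:R^-1)
     + \int[mu]_(v in D) gap_potential v))%:E.
Proof.
move=> pE; have qE : p / 2 = r + 1 by rewrite pE mulrC mulKf.
transitivity (\int[mu]_(v in D) (2 `^ (r + 1) *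
   (\int[mu]_(w in D) ((1 - dotv v w) `^ (r + 1))))%:E)%E.
  apply: eq_integral => v /[!inE] v1.
  rewrite -bounded_RintegralZl//; last exact: dist_powR_bounded_measurable.
  rewrite -EFin_Rintegral//; last exact/bmZ/dist_powR_bounded_measurable.
  by apply: eq_integral => w /[!inE] w1; rewrite sphere_dist_powR// qE.
rewrite EFin_Rintegral//; last exact/bmZ/Rintegral_dist_powR_bounded_measurable.
rewrite bounded_RintegralZl//; last exact: Rintegral_dist_powR_bounded_measurable.
congr (_ * _)%:E.
transitivity (\int[mu]_(v in D) ((1 - r) * a `^ r + r * a `^ r / a +
    (r * a `^ r / a * second_moment_form v + gap_potential v))).
  by apply: eq_Rintegral => v /[!inE] v1; rewrite Rintegral_dist_powR//; ring.
have b1 := second_moment_form_bounded_measurable.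
have b2 := gap_potential_bounded_measurable.
rewrite bounded_RintegralD//; last 2 first.
- exact: bounded_measurable_cst.
- by apply: bounded_measurableD => //; exact: bmZ.
rewrite sphere_Rintegral_cst bounded_RintegralD//; last exact: bmZ.
rewrite bounded_RintegralZl// Rintegral_second_moment_form.
rewrite /a; set A := _ `^ r.
have n1 : n%:R != 0 :> R by rewrite pnatr_eq0 -lt0n.
have n2 : n%:R + 1 != 0 :> R by rewrite gt_eqF// ltr_wpDl.
by field; rewrite n1.
Qed.

Lemma energy_ge p : p = 2 * (r + 1) ->
  ((2 `^ (r + 1) * a `^ r)%:E <= energy p mu)%E.
Proof.
move=> pE; rewrite energyE// lee_fin ler_wpM2l ?powR_ge0// -addrA lerDl addr_ge0//.
  rewrite mulr_ge0 ?subr_ge0 ?second_moment_sqr_ge//.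
  by rewrite divr_ge0 ?mulr_ge0 ?powR_ge0// ltW// (lt_trans ltr01).
by apply: Rintegral_ge0; exact: gap_potential_ge0.
Qed.

(** When the energy is minimal the tangent gap has integral 0; as it is
    nonnegative, it vanishes almost everywhere, first in v and then in w. *)
Lemma energy_min_gap p : p = 2 * (r + 1) ->
  energy p mu = (2 `^ (r + 1) * a `^ r)%:E ->
  {ae mu, forall v, D v -> {ae mu, forall w, D w -> dotv v w = 1 \/ dotv v w = - n%:R^-1}}.
Proof.
have two_neq0 : 2 `^ (r + 1) != 0 :> R by rewrite gt_eqF// powR_gt0.
move=> pE; rewrite energyE// => -[] /(mulfI two_neq0).
rewrite -addrA -[RHS]addr0 => /addrI E.
have I0 : 0 <= \int[mu]_(v in D) gap_potential v.
  by apply: Rintegral_ge0; exact: gap_potential_ge0.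
have M0 : 0 <= r * a `^ r / a * (\sum_i \sum_j second_moment i j ^+ 2 - n%:R^-1).
  rewrite mulr_ge0 ?subr_ge0 ?second_moment_sqr_ge//.
  by rewrite divr_ge0 ?mulr_ge0 ?powR_ge0// ltW// (lt_trans ltr01).
have I : \int[mu]_(v in D) gap_potential v = 0 by move: E I0 M0; lra.
have := Rintegral_eq0_ae mD gap_potential_bounded_measurable gap_potential_ge0 I.
apply: filterS => v h v1.
have := Rintegral_eq0_ae mD (sphere_gap_bounded_measurable v1)
  (fun w => @sphere_gap_ge0 v w v1) (h v1).
apply: filterS => w g w1.
have s0 : 0 <= 1 - dotv v w.
  by rewrite subr_ge0 (le_trans (ler_norm _))// sphere_dotv_le1.
have := tangent_gap_eq0 r1 a0 s0 (g w1).
by rewrite /a => -[e|e]; [left|right]; move: e; lra.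
Qed.

End Energy.
End CenteredMeasure.

(** * Regular simplices and their Gram matrix *)

Definition simplex_gram (R : realType) (n : nat) (v : 'I_n.+1 -> 'rV[R]_n) : Prop :=
  forall i j, dotv (v i) (v j) = if i == j then 1 else - n%:R^-1.

Lemma dotv_sumr (R : realType) n I (s : seq I) (u : 'rV[R]_n) (F : I -> 'rV[R]_n) :
  dotv u (\sum_(i <- s) F i) = \sum_(i <- s) dotv u (F i).
Proof.
elim: s => [|i s ih]; last by rewrite !big_cons dotvDr ih.
by rewrite !big_nil -(scale0r u) dotvZr mul0r.
Qed.

Lemma sum_diag_offdiag (R : realType) m (i : 'I_m.+1) (c g : R) :
  \sum_(j < m.+1) (if i == j then c else g) = c + m%:R * g.
Proof.
rewrite (bigD1 i)//= eqxx; congr (_ + _).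
rewrite (eq_bigr (fun=> g)); last by move=> j; rewrite eq_sym => /negPf ->.
by rewrite sumr_const cardC1 card_ord mulr_natl.
Qed.

Section SimplexGram.
Context (R : realType) (n : nat) (n0 : (0 < n)%N).
Implicit Types u v : 'I_n.+1 -> 'rV[R]_n.

Let nn0 : n%:R != 0 :> R. Proof. by rewrite pnatr_eq0 -lt0n. Qed.
Let a : R := 1 + n%:R^-1.
Let a0 : a != 0. Proof. by rewrite gt_eqF// ltr_wpDr ?invr_ge0. Qed.

(** The sum is orthogonal to every vertex, hence to itself. *)
Lemma simplex_gram_sum0 v : simplex_gram v -> \sum_i v i = 0.
Proof.
move=> gv; apply: dotvv_eq0; rewrite dotv_sumr; apply: big1 => j _.
rewrite dotvC dotv_sumr (eq_bigr _ (fun i _ => gv j i)) sum_diag_offdiag.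
by rewrite mulrN mulfV// subrr.
Qed.

Lemma simplex_gram_sphere v i : simplex_gram v -> unit_sphere R n (v i).
Proof. by move=> gv; apply/unit_sphereE; rewrite gv eqxx. Qed.

Lemma simplex_gram_regular v : simplex_gram v -> regular_simplex v.
Proof.
move=> gv; split; first by move=> i; exact: simplex_gram_sphere.
  move=> i j vij; apply/eqP/negPn/negP => ij; have := gv i j.
  rewrite vij gv eqxx (negPf ij) => h; have : 0 < n%:R^-1 :> R.
    by rewrite invr_gt0 ltr0n.
  by move: h; lra.
exists (Num.sqrt (2 * a)) => i j ij.
by rewrite sphere_dist ?gv ?(negPf ij) ?opprK//; exact: simplex_gram_sphere.
Qed.

Lemma linear_dependence v :
  exists2 c : 'I_n.+1 -> R, \sum_i c i *: v i = 0 & exists i, c i != 0.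
Proof.
pose V : 'M[R]_(n.+1, n) := \matrix_i v i.
have : kermx V != 0.
  by rewrite kermx_eq0 /row_free neq_ltn ltnS rank_leq_col.
move=> /rowV0Pn[c /sub_kermxP cV c0].
exists (fun i => c ord0 i).
  rewrite -[RHS]cV mulmx_sum_row; apply: eq_bigr => i _.
  by rewrite rowK.
apply/existsP; apply: contra_neqT c0 => /existsPn h; apply/rowP => i.
by rewrite mxE; apply/eqP/negPn/h.
Qed.

(** Let g be the common scalar product of distinct vertices, and take the scalar
    product of a nontrivial linear relation between the vertices with each of
    them: (1 - g) c_j = - g S, where S is the sum of the coefficients c_j.  Here
    S is not 0, as otherwise all the c_j would be 0, and summing over j gives
    1 - g = - (n + 1) g. *)
Lemma regular_simplex_gram v : regular_simplex v -> simplex_gram v.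
Proof.
move=> [v1 vinj [d vd]]; pose g := 1 - d ^+ 2 / 2.
have gv i j : dotv (v i) (v j) = if i == j then 1 else g.
  have [->|ij] := eqVneq i j; first exact/unit_sphereE.
  have := vd i j ij; rewrite /g => <-; rewrite sphere_dist// sqr_sqrtr.
    by field.
  by rewrite -sphere_dotvBB// dotvv_ge0.
have g1 : g != 1.
  have i01 : ord0 != ord_max :> 'I_n.+1 by rewrite -val_eqE/= eq_sym -lt0n.
  apply: contra_neq i01 => g1; apply: vinj; apply: sphere_dotv_eq1 => //.
  by rewrite gv; case: ifP.
have [c cv0 [k ck]] := linear_dependence v.
pose S := \sum_i c i.
have cS j : (1 - g) * c j = - g * S.
  have : dotv (v j) (\sum_i c i *: v i) = 0 by rewrite cv0 -(scale0r (v j)) dotvZr mul0r.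
  rewrite dotv_sumr (bigD1 j)//= dotvZr gv eqxx.
  rewrite (eq_bigr (fun i => g * c i)); last first.
    by move=> i ij; rewrite dotvZr gv eq_sym (negPf ij) mulrC.
  rewrite -mulr_sumr => h.
  by rewrite /S [\sum_i _](bigD1 j)//=; move: h; set T := \sum_(i | _) _; lra.
have S0 : S != 0.
  apply: contra_neq ck => S0; have := cS k; rewrite S0 mulr0 => /eqP.
  by rewrite mulf_eq0 subr_eq0 eq_sym (negPf g1) => /eqP.
have : (1 - g) * S = n.+1%:R * (- g * S).
  rewrite {1}/S mulr_sumr (eq_bigr _ (fun j _ => cS j)).
  by rewrite sumr_const card_ord mulr_natl.
have -> : n.+1%:R * (- g * S) = n.+1%:R * - g * S by rewrite mulrA.
move=> /(mulIf S0); rewrite -natr1 => gE i j; rewrite gv; case: ifP => // _.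
apply: (mulfI nn0); rewrite mulrN mulfV//; move: gE; set x := n%:R; lra.
Qed.

(** The first vertex is a multiple of the all-ones vector, and the others are
    the vectors y e_i - b (1, ..., 1), where y^2 = 1 + 1/n and b is chosen so
    that the sum of the vertices is 0. *)
Lemma simplex_gram_exists : exists v : 'I_n.+1 -> 'rV[R]_n, simplex_gram v.
Proof.
pose x : R := Num.sqrt n%:R^-1; pose y : R := Num.sqrt a.
have xx : x ^+ 2 = n%:R^-1 by rewrite sqr_sqrtr ?invr_ge0.
have yy : y ^+ 2 = a by rewrite sqr_sqrtr// addr_ge0// invr_ge0.
pose b := (y + x) / n%:R.
pose e (i : 'I_n) : 'rV[R]_n := y *: delta_mx 0 i - b *: const_mx 1.
have d1 (u : 'rV[R]_n) : dotv u (const_mx 1) = \sum_i u ord0 i.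
  by apply: eq_bigr => i _; rewrite mxE mulr1.
have dd (u : 'rV[R]_n) i : dotv u (delta_mx 0 i) = u ord0 i.
  rewrite /dotv (bigD1 i)//= mxE !eqxx mulr1 big1 ?addr0// => j ji.
  by rewrite mxE (negPf ji) andbF mulr0.
have c1 i : (const_mx 1 : 'rV[R]_n) ord0 i = 1 by rewrite mxE.
have s1 : \sum_i (const_mx 1 : 'rV[R]_n) ord0 i = n%:R.
  by rewrite (eq_bigr _ (fun i _ => c1 i)) sumr_const card_ord.
have ee i j : dotv (e i) (e j) = if i == j then 1 else - n%:R^-1.
  rewrite {2}/e dotvDr dotvNr !dotvZr dd d1.
  have -> : \sum_k e i ord0 k = y - b * n%:R.
    rewrite -d1 dotvC /e dotvDr dotvNr !dotvZr dd d1 s1 c1 mulr1; ring.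
  rewrite /e !mxE eqxx/= eq_sym.
  have -> : y - b * n%:R = - x by rewrite /b divfK//; ring.
  have bE : b * (y - x) = n%:R^-1.
    rewrite /b mulrAC (_ : (y + x) * (y - x) = y ^+ 2 - x ^+ 2); last by ring.
    by rewrite yy xx /a addrK mul1r.
  case: eqP => _ /=; rewrite ?mulr1 ?mulr0 ?sub0r.
    transitivity (y ^+ 2 - b * (y - x)); first by ring.
    by rewrite bE yy /a addrK.
  by rewrite -bE; ring.
pose f : 'rV[R]_n := x *: const_mx 1.
have ef i : dotv (e i) f = - n%:R^-1.
  rewrite /f dotvZr d1 -d1 dotvC /e dotvDr dotvNr !dotvZr dd d1 s1 c1 mulr1.
  by rewrite /b divfK// -xx; ring.
have ff : dotv f f = 1.
  rewrite {2}/f dotvZr d1 -d1 dotvC /f dotvZr d1 s1 mulrA -expr2 xx mulVf//.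
exists (fun i => if unlift ord0 i is Some j then e j else f) => i j.
have [i'|] := unliftP ord0 i; have [j'|] := unliftP ord0 j => -> ->.
- by rewrite ee (inj_eq (@lift_inj _ _)).
- by rewrite ef eq_sym (negPf (neq_lift _ _)).
- by rewrite dotvC ef (negPf (neq_lift _ _)).
- by rewrite ff eqxx.
Qed.

Local Notation vmx v := (\matrix_(i < n.+1) v i).

Lemma simplex_gramE v : simplex_gram v ->
  vmx v *m (vmx v)^T = a%:M - n%:R^-1 *: const_mx 1.
Proof.
move=> gv; apply/matrixP => i j; rewrite !mxE.
transitivity (dotv (v i) (v j)); first by rewrite /dotv; apply: eq_bigr => k _; rewrite !mxE.
by rewrite gv /a; case: eqP => _ /=; rewrite ?mulr1n ?mulr0n; ring.
Qed.

(** The Gram matrix V V^T is a I - J/n, with J the all-ones matrix, and J V = 0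
    because the sum of the vertices is 0. *)
Lemma simplex_gram_mul v : simplex_gram v ->
  vmx v *m (vmx v)^T *m vmx v = a *: vmx v.
Proof.
move=> gv; rewrite simplex_gramE// mulmxBl mul_scalar_mx -scalemxAl.
suff -> : const_mx 1 *m vmx v = 0 :> 'M[R]_(n.+1, n) by rewrite scaler0 subr0.
apply/matrixP => i j; rewrite !mxE.
have /rowP/(_ j) := simplex_gram_sum0 gv; rewrite summxE mxE => vj.
by rewrite -[RHS]vj; apply: eq_bigr => k _; rewrite !mxE mul1r.
Qed.

Lemma mxtrace_mul_tr_eq0 (A : 'M[R]_n) : \tr (A *m A^T) = 0 -> A = 0.
Proof.
have E i : (A *m A^T) i i = dotv (row i A) (row i A).
  by rewrite mxE; apply: eq_bigr => j _; rewrite !mxE.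
rewrite /mxtrace (eq_bigr _ (fun i _ => E i)) => h; apply/row_matrixP => i.
rewrite row0; apply: dotvv_eq0.
exact: (psumr_eq0P (fun i _ => dotvv_ge0 (row i A)) h).
Qed.

(** The n x n matrix S = V^T V satisfies S^2 = a S and has trace n a, so that
    the trace of (S - a I)^2, the sum of the squares of the entries of the
    symmetric matrix S - a I, is 0. *)
Lemma simplex_tight_frame v : simplex_gram v -> (vmx v)^T *m vmx v = a%:M.
Proof.
move=> gv; set S := _ *m _; apply/eqP; rewrite -subr_eq0; apply/eqP.
apply: mxtrace_mul_tr_eq0.
have ST : S^T = S by rewrite trmx_mul trmxK.
have SS : S *m S = a *: S.
  by rewrite {1}/S -mulmxA [vmx v *m S]mulmxA simplex_gram_mul// -scalemxAr.
have trS : \tr S = a * n%:R.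
  rewrite /S mxtrace_mulC simplex_gramE//.
  rewrite /mxtrace (eq_bigr (fun=> 1)); last first.
    by move=> i _; rewrite !mxE eqxx /a mulr1n; ring.
  by rewrite sumr_const card_ord /a mulrDl mulVf// mul1r natr1.
rewrite linearB/= ST tr_scalar_mx mulmxBl !mulmxBr SS -scalar_mxM.
rewrite mul_mx_scalar mul_scalar_mx subrr add0r opprB.
by rewrite linearB/= linearZ/= mxtrace_scalar trS mulr_natr; ring.
Qed.

Lemma simplex_gram_rotation u v : simplex_gram u -> simplex_gram v ->
  exists2 U : 'M[R]_n, orthogonalmx U & forall i, v i *m U = u i.
Proof.
move=> gu gv; exists (a^-1 *: ((vmx v)^T *m vmx u)); last first.
  move=> i; rewrite -[v i](@rowK R n.+1 n (fun i => v i)) -row_mul -scalemxAr mulmxA.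
  by rewrite simplex_gramE// -(simplex_gramE gu) simplex_gram_mul// scalerA mulVf// scale1r rowK.
rewrite /orthogonalmx linearZ/= trmx_mul trmxK -scalemxAl -scalemxAr scalerA.
rewrite mulmxA -[_ *m _ *m (vmx u)^T]mulmxA (simplex_gramE gu) -(simplex_gramE gv).
rewrite -mulmxA simplex_gram_mul// -scalemxAr simplex_tight_frame//.
by rewrite scalerA scale_scalar_mx; congr (_%:M); field.
Qed.

End SimplexGram.

(** * The measure of a simplex *)

Section UniformOnPoints.
Context (R : realType) (n : nat) (v : 'I_n.+1 -> 'rV[R]_n).

Lemma mu_simE (A : set (borel_rV R n)) :
  mu_sim v A = (n.+1%:R^-1%:E * \sum_i @dirac _ (borel_rV R n) (v i) R A)%E.
Proof. exact: uniform_on_pointsE. Qed.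

Hypothesis v1 : forall i, unit_sphere R n (v i).
Local Notation D := (unit_sphere R n).
Let mD : measurable (D : set (borel_rV R n)) := @measurable_sphere R n.

Lemma mu_sim_sphere : mu_sim v D = 1%E.
Proof.
rewrite mu_simE (eq_bigr (fun=> 1%E)); last first.
  by move=> i _; rewrite diracE mem_set//; exact: v1.
by rewrite sumEFin big_const_ord iter_addr_0 -EFinM mulVf ?pnatr_eq0.
Qed.

Lemma ge0_integral_mu_sim (f : borel_rV R n -> R) :
  measurable_fun (D : set (borel_rV R n)) f -> (forall x, D x -> 0 <= f x) ->
  (\int[mu_sim v]_(x in D) (f x)%:E = (n.+1%:R^-1 * \sum_i f (v i))%:E)%E.
Proof.
move=> mf f0; rewrite /mu_sim.
have mf' : measurable_fun (D : set (borel_rV R n)) (EFin \o f).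
  exact/measurable_EFinP.
have f0' x : D x -> (0 <= (EFin \o f) x)%E by move=> Dx; rewrite lee_fin f0.
rewrite [LHS](ge0_integral_mscale _ mD _ mf' f0').
rewrite (ge0_integral_measure_sum _ mD f0' mf') EFinM -sumEFin; congr (_ * _)%E.
apply: eq_bigr => i _; rewrite integral_dirac// diracE inord_val mem_set ?mul1e//.
Qed.

Lemma Rintegral_mu_sim (f : borel_rV R n -> R) :
  bounded_measurable (D : set (borel_rV R n)) f ->
  \int[mu_sim v]_(x in D) f x = n.+1%:R^-1 * \sum_i f (v i).
Proof.
move=> bf; have [mf [C fC]] := bf.
have bC := @bounded_measurable_cst _ (borel_rV R n) R D C.
(* Integrals against a sum of measures split for nonnegative functions, so
   f is shifted by a bound of its absolute value. *)
have : \int[mu_sim v]_(x in D) (f x + C) = n.+1%:R^-1 * \sum_i (f (v i) + C).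
  rewrite {1}/Rintegral ge0_integral_mu_sim//; first exact: measurable_funD.
  by move=> x /fC; rewrite ler_norml => /andP[+ _]; lra.
rewrite bounded_RintegralD// Rintegral_cst//= mu_sim_sphere/= big_split/= sumr_const.
rewrite card_ord mulr1 mulrDr -[C *+ _]mulr_natl mulKf ?pnatr_eq0//.
exact: addIr.
Qed.

End UniformOnPoints.

Section SimplexMeasure.
Context (R : realType) (n : nat) (n0 : (0 < n)%N) (v : 'I_n.+1 -> 'rV[R]_n).
Hypothesis gv : simplex_gram v.
Local Notation D := (unit_sphere R n).
Let mD : measurable (D : set (borel_rV R n)) := @measurable_sphere R n.
Let v1 i : D (v i) := simplex_gram_sphere i gv.

Lemma mu_sim_centered : centered_on_sphere R n (mu_sim v).
Proof.
split; first exact: mu_sim_sphere.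
apply/rowP => i; rewrite !mxE Rintegral_mu_sim//; last first.
  exact: coord_bounded_measurable.
by have /rowP/(_ i) := simplex_gram_sum0 n0 gv; rewrite summxE mxE => ->; rewrite mulr0.
Qed.

Lemma energy_mu_sim (p : R) (r := p / 2 - 1) : 1 < r ->
  energy p (mu_sim v) = (2 `^ (r + 1) * (1 + n%:R^-1) `^ r)%:E.
Proof.
move=> r1; have qE : p / 2 = r + 1 by rewrite /r subrK.
have q0 : 0 <= r + 1 by move: r1; lra.
pose f (x w : 'rV[R]_n) := 2 `^ (r + 1) * (1 - dotv x w) `^ (r + 1).
have bf x : D x -> bounded_measurable (D : set (borel_rV R n)) (f x).
  move=> x1; apply: bounded_measurableM; first exact: bounded_measurable_cst.
  exact: dist_powR_bounded_measurable.
have bF : bounded_measurable (D : set (borel_rV R n))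
    (fun x => n.+1%:R^-1 * \sum_j f (v j) x).
  apply: bounded_measurableM; first exact: bounded_measurable_cst.
  by apply: bounded_measurable_sum => j; exact: bf.
transitivity (\int[mu_sim v]_(x in D) (n.+1%:R^-1 * \sum_j f (v j) x)%:E)%E.
  apply: eq_integral => x /[!inE] x1.
  transitivity (\int[mu_sim v]_(w in D) (f x w)%:E)%E.
    by apply: eq_integral => w /[!inE] w1; rewrite sphere_dist_powR// qE.
  rewrite (EFin_Rintegral _ mD (bf x x1)) (Rintegral_mu_sim v1 (bf x x1)).
  by congr (_ * _)%:E; apply: eq_bigr => j _; rewrite /f dotvC.
rewrite (EFin_Rintegral _ mD bF) (Rintegral_mu_sim v1 bF); congr EFin.
have n1 : n%:R != 0 :> R by rewrite pnatr_eq0 -lt0n.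
have n2 : 1 + n%:R != 0 :> R by rewrite gt_eqF// ltr_wpDr.
have a0 : 0 < 1 + n%:R^-1 :> R by rewrite ltr_wpDr ?invr_ge0.
have E i : \sum_j f (v j) (v i) =
    2 `^ (r + 1) * (n%:R * ((1 + n%:R^-1) `^ r * (1 + n%:R^-1))).
  rewrite -mulr_sumr; congr (_ * _).
  rewrite (eq_bigr (fun j => if i == j then 0 else (1 + n%:R^-1) `^ (r + 1))).
    rewrite sum_diag_offdiag add0r powRD ?powRr1 ?ltW//.
    by apply/implyP => _; rewrite gt_eqF.
  move=> j _; rewrite dotvC gv; case: ifP => _; last by rewrite opprK.
  by rewrite subrr powR0// gt_eqF//; move: r1; lra.
rewrite (eq_bigr _ (fun i _ => congr1 ( *%R n.+1%:R^-1) (E i))).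
rewrite sumr_const card_ord -[_ *+ n.+1]mulr_natl -natr1.
field.
by rewrite n1 addrC n2.
Qed.

End SimplexMeasure.

(** * The case of equality *)

Section Equality.
Context (R : realType) (n : nat) (n0 : (0 < n)%N) (mu : probability (borel_rV R n) R).
Hypothesis mu_centered : centered_on_sphere R n mu.
Local Notation D := (unit_sphere R n).
Let mD : measurable (D : set (borel_rV R n)) := @measurable_sphere R n.

(** The points v that see almost every point as a vertex of a regular simplex
    sees the vertices. *)
Definition simplex_point (v : 'rV[R]_n) : Prop :=
  D v /\ {ae mu, forall w, D w -> dotv v w = 1 \/ dotv v w = - n%:R^-1}.

(** Almost everywhere <v, w> is (1 + 1/n) 1_{v}(w) - 1/n, and its integral is 0
    because mu is centered. *)
Lemma simplex_point_atom v : simplex_point v ->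
  mu ([set v] : set (borel_rV R n)) = (n.+1%:R^-1)%:E.
Proof.
move=> [v1 aev]; have mv := measurable_point v.
have bi : bounded_measurable (D : set (borel_rV R n)) (\1_[set v] : _ -> R).
  split; first exact: measurable_indic.
  by exists 1 => w _; rewrite ger0_norm// indicE; case: (_ \in _).
have b1 : bounded_measurable (D : set (borel_rV R n))
   (fun w => (1 + n%:R^-1) * \1_[set v] w : R).
  by apply: bounded_measurableM => //; exact: bounded_measurable_cst.
have b2 := @bounded_measurable_cst _ (borel_rV R n) R D (- n%:R^-1).
have I1 : \int[mu]_(w in D) (\1_[set v] w) = fine (mu [set v]).
  rewrite /Rintegral integral_indic//; congr (fine (mu _)).
  by rewrite setIidl// => _ ->.
have : \int[mu]_(w in D) dotv v w =
    \int[mu]_(w in D) ((1 + n%:R^-1) * \1_[set v] w + - n%:R^-1).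
  apply: ae_eq_Rintegral => //; first exact: dotv_bounded_measurable.
    exact: bounded_measurableD.
  move: aev; apply: (@filterS (borel_rV R n)) => w h w1; rewrite indicE.
  have [<-|vw] := eqVneq v w.
    rewrite mem_set//= mulr1 addrK; exact/unit_sphereE.
  rewrite memNset/=; last by move=> /esym/eqP; rewrite (negPf vw).
  rewrite mulr0 add0r; case: (h w1) => // /(sphere_dotv_eq1 v1 w1)/eqP.
  by rewrite (negPf vw).
rewrite Rintegral_dotv// bounded_RintegralD// bounded_RintegralZl// I1 sphere_Rintegral_cst//.
move=> /eqP; rewrite eq_sym subr_eq add0r => /eqP h.
rewrite -[LHS]fineK ?fin_num_measure//; congr EFin.
have nn0 : n%:R != 0 :> R by rewrite pnatr_eq0 -lt0n.
have n1 : n%:R + 1 != 0 :> R by rewrite gt_eqF// ltr_wpDl.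
apply: (@mulfI _ (1 + n%:R^-1)); first by rewrite gt_eqF// ltr_wpDr ?invr_ge0.
by rewrite h -natr1; field; rewrite n1.
Qed.

(** As w is an atom, what holds for almost every point holds at w. *)
Lemma simplex_point_dotv v w : simplex_point v -> simplex_point w -> v != w ->
  dotv v w = - n%:R^-1.
Proof.
move=> [v1 aev] hw; have w1 := hw.1; apply: contra_neqP => vw.
apply/eqP/negPn/negP => vw'.
have : mu.-negligible ([set w] : set (borel_rV R n)).
  apply: negligibleS aev => _ -> /(_ w1)[|//].
  by move/(sphere_dotv_eq1 v1 w1)/eqP; rewrite (negPf vw').
move/(negligibleP mu (measurable_point w)) => mw0.
have := simplex_point_atom hw; rewrite mw0 => /eqP.
by rewrite eq_sym eqe invr_eq0 pnatr_eq0.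
Qed.

Lemma set_seq_cons (T : eqType) (x : T) (s : seq T) :
  [set` x :: s] = [set x] `|` [set` s].
Proof.
by apply/seteqP; split=> y /=; rewrite inE => /predU1P.
Qed.

Lemma measurable_seq (s : seq 'rV[R]_n) : measurable ([set` s] : set (borel_rV R n)).
Proof.
elim: s => [|x s ih]; first by rewrite set_nil; exact: measurable0.
by rewrite set_seq_cons; apply: measurableU => //; exact: measurable_point.
Qed.

Lemma simplex_points_measure (s : seq 'rV[R]_n) : uniq s ->
  (forall v, v \in s -> simplex_point v) ->
  mu ([set` s] : set (borel_rV R n)) = ((size s)%:R / n.+1%:R)%:E.
Proof.
elim: s => [|x s ih]/=; first by rewrite set_nil measure0 mul0r.
move=> /andP[xs us] h; rewrite set_seq_cons.
transitivity (mu ([set x] : set (borel_rV R n)) +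
              mu ([set` s] : set (borel_rV R n)))%E.
  apply: measureU; [exact: measurable_point|exact: measurable_seq|].
  by apply/seteqP; split=> // y [/= ->]; rewrite (negPf xs).
rewrite ih//; last by move=> v vs; apply: h; rewrite inE vs orbT.
rewrite simplex_point_atom; last by apply: h; rewrite mem_head.
by rewrite -EFinD -[in RHS]natr1 mulrDl mul1r addrC.
Qed.

Hypothesis ae_simplex_point : {ae mu, forall v, D v -> simplex_point v}.

(** At most n atoms of mass 1/(n+1) cannot carry the whole mass. *)
Lemma simplex_point_notin (s : seq 'rV[R]_n) : uniq s -> (size s <= n)%N ->
  (forall v, v \in s -> simplex_point v) ->
  exists2 v, simplex_point v & v \notin s.
Proof.
move=> us sn hs; apply: contrapT => H.
have DE : D `<=` [set` s] `|` ~` [set v | D v -> simplex_point v].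
  move=> v v1; have [vs|vs] := boolP (v \in s); [by left|right => /= h].
  by apply: H; exists v => //; exact: h.
have [N [mN N0 sN]] := ae_simplex_point.
have : (mu (D : set (borel_rV R n)) <=
    mu ([set` s] : set (borel_rV R n)) + mu N)%E.
  apply: le_trans (measureU2 mu (measurable_seq s) mN).
  apply: le_measure; rewrite ?inE//; first by apply: measurableU => //; exact: measurable_seq.
  by apply: subset_trans DE _; exact: setUS.
rewrite mu_centered.1 simplex_points_measure// N0 adde0 lee_fin.
by rewrite ler_pdivlMr// mul1r ler_nat leqNgt ltnS sn.
Qed.

Lemma simplex_points_exist k : (k <= n.+1)%N ->
  exists s : seq 'rV[R]_n, [/\ uniq s, size s = k &
    forall v, v \in s -> simplex_point v].
Proof.
elim: k => [_|k ih kn]; first by exists [::].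
have [s [us sk hs]] := ih (ltnW kn).
have [|v hv vs] := simplex_point_notin us _ hs; first by rewrite sk.
exists (v :: s); split=> /=; [by rewrite vs|by rewrite sk|].
by move=> w; rewrite inE => /predU1P[->//|]; exact: hs.
Qed.

(** Any n+1 simplex points carry the whole mass, so mu A only depends on the
    number of them that are in A. *)
Lemma ae_simplex_point_uniform : exists2 u : 'I_n.+1 -> 'rV[R]_n, simplex_gram u &
  forall A : set (borel_rV R n), measurable A -> mu A = mu_sim u A.
Proof.
have [s [us sn hs]] := simplex_points_exist (leqnn n.+1).
pose u (i : 'I_n.+1) := nth 0 s i.
have us' i : u i \in s by apply: mem_nth; rewrite sn.
have sE : s = [seq u i | i <- enum 'I_n.+1].
  apply: (@eq_from_nth _ 0); first by rewrite size_map size_enum_ord.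
  move=> i; rewrite sn => isn.
  by rewrite (nth_map ord0) ?size_enum_ord// /u nth_enum_ord.
exists u => [i j|A mA].
  have [->|ij] := eqVneq i j; first exact/unit_sphereE/(hs _ (us' j)).1.
  apply: simplex_point_dotv; [exact/hs/us'|exact/hs/us'|].
  by rewrite /u nth_uniq ?sn.
have ms := measurable_seq s.
have ms0 : mu (~` [set` s] : set (borel_rV R n)) = 0%E.
  rewrite probability_setC// simplex_points_measure// sn divff ?pnatr_eq0//.
  by rewrite subee.
have -> : mu A = mu (A `&` [set` s] : set (borel_rV R n)).
  rewrite -[in LHS](setIT A) -(setUv [set` s]) setIUr measureU//; last 3 first.
  - exact: measurableI.
  - by apply: measurableI => //; exact: measurableC.
  - by rewrite -setIIr setICr setI0.
  rewrite [X in (_ + X)%E](_ : _ = 0%E) ?adde0//.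
  apply: (subset_measure0 _ (measurableC ms)) => //.
  by apply: measurableI => //; exact: measurableC.
have -> : A `&` [set` s] = [set` [seq x <- s | x \in A]].
  apply/seteqP; split=> x /=; rewrite mem_filter.
    by move=> [Ax ->]; rewrite mem_set.
  by move=> /andP[/set_mem].
rewrite simplex_points_measure ?filter_uniq//; last first.
  by move=> x; rewrite mem_filter => /andP[_]; exact: hs.
rewrite mu_simE mulrC EFinM; congr (_ * _)%E.
rewrite size_filter {1}sE count_map -sum1_count big_mkcond/= big_enum/=.
rewrite natr_sum -sumEFin; apply: eq_bigr => i _.
by rewrite diracE; case: (_ \in _).
Qed.

End Equality.

(** * Minimizers *)

Theorem theorem4p11 (R : realType) (n : nat) (p : R) (hn : (2 <= n)%N)
    (hp : 4 < p) :
  [/\ exists v : 'I_n.+1 -> 'rV[R]_n, regular_simplex v,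
      forall v : 'I_n.+1 -> 'rV[R]_n, regular_simplex v ->
        is_minimizer p (mu_sim v) /\
        (forall mu : probability (borel_rV R n) R,
           is_minimizer p mu -> equal_up_to_rotation mu (mu_sim v)) &
      min_energy n p
      = (2 `^ (p / 2) * (1 + n%:R^-1) `^ (p / 2 - 1))%:E ].
Proof.
have n0 : (0 < n)%N by exact: ltnW.
pose r := p / 2 - 1.
have r1 : 1 < r by rewrite /r ltrBrDr ltr_pdivlMr//; move: hp; lra.
have pE : p = 2 * (r + 1) by rewrite /r subrK mulrC divfK.
have qE : p / 2 = r + 1 by rewrite /r subrK.
have min_sim (v : 'I_n.+1 -> 'rV[R]_n) : simplex_gram v -> is_minimizer p (mu_sim v).
  move=> gv; split; first exact: mu_sim_centered.
  by move=> nu cnu; rewrite energy_mu_sim// energy_ge.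
have [v0 gv0] := simplex_gram_exists R n0.
split.
- by exists v0; exact: simplex_gram_regular.
- move=> v /(regular_simplex_gram n0) gv; split; first exact: min_sim.
  move=> mu [cmu mu_min].
  have Emu : energy p mu = (2 `^ (r + 1) * (1 + n%:R^-1) `^ r)%:E.
    apply/eqP; rewrite eq_le energy_ge// andbT -(energy_mu_sim n0 gv r1).
    exact/mu_min/mu_sim_centered.
  have ae_mu : {ae mu, forall v, unit_sphere R n v -> simplex_point mu v}.
    move: (energy_min_gap cmu r1 n0 pE Emu).
    apply: (@filterS (borel_rV R n)) => x h x1.
    by split => //; exact: h.
  have [u gu muE] := ae_simplex_point_uniform n0 cmu ae_mu.
  have [U oU vU] := simplex_gram_rotation n0 gu gv.
  exists U => // A mA; rewrite muE// /pushforward !mu_simE.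
  congr (_ * _)%E; apply: eq_bigr => i _; rewrite !diracE -vU.
  by congr ((_ : bool)%:R%:E); apply/idP/idP; rewrite !inE.
- rewrite -/r qE -(energy_mu_sim n0 gv0 r1).
  have [cv0 v0_min] := min_sim _ gv0.
  apply/eqP; rewrite eq_le; apply/andP; split.
    by apply: ereal_inf_lbound; exists (mu_sim v0).
  by apply/ereal_infP => _ [nu cnu <-]; exact: v0_min.
Qed.
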